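(* Let $G$ be the graph on $\mathbb{N}^2$ in which $x\sim y$ iff $\|x-y\|_\infty=1$, and let $f(n)=\min\{|\partial A|: A\subset\mathbb{N}^2,\ |A|=n\}$. There exist arbitrarily long runs of consecutive values of the volume for which the minimum boundary is the same: for every $L\in\mathbb{N}$ there exists $n\ge 1$ such that $f(n)=f(n+1)=\dots=f(n+L)$.
   Context: For a finite set $A\subset \mathbb{N}^2$, the edge boundary $\partial A$ is the set of edges of $G$ having exactly one endpoint in $A$, and the volume of $A$ is $|A|$. *)

(* Defs.v *)
From mathcomp Require Import all_boot all_order all_algebra.
From mathcomp Require Import finmap boolp classical_sets functions cardinality.
From mathcomp Require Import zify.

Set Implicit Arguments.
Unset Strict Implicit.
Unset Printing Implicit Defensive.

Local Open Scope classical_set_scope.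
Local Open Scope nat_scope.

(* The subtractions are in int, so they are not truncated. *)
Definition dist_infty (x y : nat * nat) : nat :=
  maxn `|(x.1%:Z - y.1%:Z)%R|%N `|(x.2%:Z - y.2%:Z)%R|%N.

Definition adj (x y : nat * nat) : bool := dist_infty x y == 1.

(* An edge is the unordered pair of its endpoints. *)
Definition edges : set {fset nat * nat} :=
  [set e | exists x y, adj x y /\ e = [fset x; y]%fset].

Definition edge_boundary (A : {fset nat * nat}) : set {fset nat * nat} :=
  [set e | edges e /\ #|` (e `&` A)%fset| = 1].

Lemma adjC (x y : nat * nat) : adj x y = adj y x.
Proof. by rewrite /adj /dist_infty; lia. Qed.

Lemma finite_edge_boundary (A : {fset nat * nat}) :
  finite_set (edge_boundary A).
Proof.
have adj_le (x y : nat * nat) : adj x y -> (y.1 < x.1.+2) && (y.2 < x.2.+2).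
  by rewrite /adj /dist_infty; lia.
apply: (@sub_finite_set _ _ (\bigcup_(x in [set` A])
  ((fun y => [fset x; y]%fset) @` (`I_x.1.+2 `*` `I_x.2.+2)))); last first.
  apply: bigcup_finite; first exact: finite_fset.
  by move=> x _; apply/finite_image/finite_setX; exact: finite_II.
move=> _ [[x [y [xy ->]]]] /eqP/cardfs1P[z zA].
have : z \in ([fset x; y] `&` A)%fset by rewrite zA inE.
rewrite !inE => /andP[/orP[] /eqP-> inA].
  by exists x => //; exists y => //=; split=> /=; case/andP: (adj_le _ _ xy).
exists y => //; exists x; last by rewrite fsetUC.
by rewrite adjC in xy; split=> /=; case/andP: (adj_le _ _ xy).
Qed.

(* [fset_set] would send an infinite set to the empty one; by
   [finite_edge_boundary] this never happens here. *)
Definition boundary_size (A : {fset nat * nat}) : nat :=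
  #|` fset_set (edge_boundary A)|.

Definition boundary_value (n m : nat) : Prop :=
  exists A : {fset nat * nat}, #|` A| = n /\ boundary_size A = m.

Lemma boundary_value_nonempty (n : nat) : exists m, `[< boundary_value n m >].
Proof.
pose A := [fset (i, 0) | i in iota 0 n]%fset.
exists (boundary_size A); apply/asboolP; exists A; split=> //.
rewrite card_in_imfset /=; last by move=> i j _ _ [].
by rewrite undup_id ?iota_uniq ?size_iota.
Qed.

Definition min_boundary (n : nat) : nat := ex_minn (boundary_value_nonempty n).

(* Main.v *)
Require Import Defs.
From mathcomp Require Import all_boot.
From mathcomp Require Import finmap boolp classical_sets cardinality zify.

(** The minimum boundary [min_boundary] is nondecreasing in the volume, and it
    is at most linear in the side on squares, hence of order at most the square
    root of the volume.  A nondecreasing sequence of naturals that grows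
    sublinearly cannot increase within every window of length [L], so some
    window is constant.

    Monotonicity ([min_boundary_nondecreasing]) comes from deleting one point:
    in a nonempty finite set [A], let [p] be the rightmost point of the topmost
    row.  The neighbours of [p] in [A] are among its left neighbour and the
    (at most three) neighbours below it.  Flipping the former to the right of [p]
    and the latter above [p] gives as many neighbours of [p] outside [A].  So
    deleting [p] creates no more boundary edges than it destroys. *)

Set Implicit Arguments.
Unset Strict Implicit.
Unset Printing Implicit Defensive.

Lemma boundary_edgeP (A : {fset nat * nat}) (e : {fset nat * nat}) :
  edge_boundary A e <->
  exists x y, [/\ adj x y, x \in A, y \notin A & e = [fset x; y]%fset].
Proof.
split; last first.
  move=> [x [y [xy xA yA ->]]]; split; first by exists x, y.
  apply/eqP/cardfs1P; exists x; apply/fsetP => z; rewrite !inE.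
  case: (eqVneq z x) => [->|_] /=; first by rewrite xA.
  by apply/negP => /andP[/eqP-> ]; rewrite (negbTE yA).
move=> [[x [y [xy ->]]]] /eqP/cardfs1P[z zA].
have memE u : (u \in ([fset x; y] `&` A)%fset) = (u == z).
  by rewrite zA !inE.
have xNy : x != y.
  by apply: contraTneq xy => ->; rewrite /adj /dist_infty; lia.
have := memE x; have := memE y; rewrite !inE !eqxx orbT /= => yE xE.
have := memE z; rewrite !inE eqxx => /andP[/orP[] /eqP zE _].
  exists x, y; rewrite xE yE zE eqxx eq_sym xNy; split=> //.
exists y, x; rewrite xE yE zE eqxx xNy fsetUC adjC; split=> //.
Qed.

Lemma boundary_size_le (A : {fset nat * nat}) (s : seq {fset nat * nat}) :
  (forall e, edge_boundary A e -> e \in s) -> boundary_size A <= size s.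
Proof.
move=> As; apply: uniq_leq_size; first exact: fset_uniq.
move=> e; rewrite in_fset_set; last exact: finite_edge_boundary.
by rewrite inE => /As.
Qed.

Lemma topmost_rightmost (s : seq (nat * nat)) : s != [::] ->
  exists2 p : nat * nat, p \in s &
    forall z : nat * nat, z \in s -> z.2 < p.2 \/ z.2 = p.2 /\ z.1 <= p.1.
Proof.
elim: s => // x [|y s] IHs _.
  by exists x; [rewrite mem_head | move=> z; rewrite inE => /eqP->; right].
have [//|p ps p_max] := IHs.
have [px|xp] : (x.2 < p.2 \/ x.2 = p.2 /\ x.1 <= p.1) \/
    (p.2 < x.2 \/ x.2 = p.2 /\ p.1 <= x.1) by lia.
  exists p; first by rewrite inE ps orbT.
  by move=> z; rewrite inE => /orP[/eqP->|/p_max].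
exists x; first exact: mem_head.
move=> z; rewrite inE => /orP[/eqP->|/p_max pz]; first by right.
by lia.
Qed.

(** Flipping left to right on the row of [p], and upside down elsewhere, keeps
    the neighbours of [p] inside the quadrant.  The central symmetry about [p]
    would not do: when [p] lies on the vertical axis it sends the neighbour at
    the lower right to a negative abscissa. *)
Definition flip (p z : nat * nat) : nat * nat :=
  if z.2 == p.2 then (p.1.*2 - z.1, z.2) else (z.1, p.2.*2 - z.2).

Lemma flip_id (p : nat * nat) : flip p p = p.
Proof. by rewrite /flip eqxx -addnn addnK; case: p. Qed.

(** Here and below the hypothesis on [z] makes the truncated subtractions in
    [flip] exact. *)
Lemma flipK (p z : nat * nat) :
  z.2 < p.2 \/ z.2 = p.2 /\ z.1 <= p.1 -> flip p (flip p z) = z.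
Proof.
case: p z => [a b] [c d]; rewrite /flip /=.
have [-> z_below|dNb z_below] /= := eqVneq d b.
  by rewrite eqxx; congr pair; lia.
by rewrite ifN; [congr pair|]; lia.
Qed.

Lemma flip_adj (p z : nat * nat) :
  z.2 < p.2 \/ z.2 = p.2 /\ z.1 <= p.1 -> adj p z -> adj p (flip p z).
Proof.
case: p z => [a b] [c d]; rewrite /flip /adj /dist_infty /=.
by have [->|db] /= := eqVneq d b; lia.
Qed.

Lemma flip_above (p z : nat * nat) :
  z.2 < p.2 \/ z.2 = p.2 /\ z.1 <= p.1 -> z != p ->
  ~ ((flip p z).2 < p.2 \/ (flip p z).2 = p.2 /\ (flip p z).1 <= p.1).
Proof.
case: p z => [a b] [c d]; rewrite /flip xpair_eqE /=.
by have [->|db] /= := eqVneq d b; lia.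
Qed.

(** Every boundary edge of the set without [p] is obtained from a boundary edge
    of [A] by flipping the edges at [p] and keeping the others: a surjection
    between the two boundaries is enough to compare their sizes. *)
Lemma boundary_size_delete_corner (A : {fset nat * nat}) (p : nat * nat) :
  p \in A ->
  (forall z : nat * nat, z \in A -> z.2 < p.2 \/ z.2 = p.2 /\ z.1 <= p.1) ->
  boundary_size (A `\ p)%fset <= boundary_size A.
Proof.
move=> pA p_max.
pose flip_edge (e : {fset nat * nat}) : {fset nat * nat} :=
  if p \in e then (flip p @` e)%fset else e.
pose s := [seq flip_edge e | e <- fset_set (edge_boundary A)].
have flip_edge_in e e' : e' = flip_edge e -> edge_boundary A e -> e' \in s.
  move=> -> Ae; apply: map_f; rewrite in_fset_set ?inE //.
  exact: finite_edge_boundary.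
have -> : boundary_size A = size s by rewrite size_map.
apply: boundary_size_le => e /boundary_edgeP[x [y [xy]]].
rewrite !inE negb_and negbK => /andP[xp xA] y_out ->.
case: (eqVneq y p) xy y_out => [->|yp] xy y_out; last first.
  (* The edge avoids [p]: it is already a boundary edge of [A]. *)
  apply: (@flip_edge_in [fset x; y]%fset); last by apply/boundary_edgeP; exists x, y.
  by rewrite /flip_edge !inE !(eq_sym p) (negbTE xp) (negbTE yp).
(* The edge joins [p] to a point [x] of [A], and [flip p x] is outside [A]. *)
have px : adj p x by rewrite adjC.
have x_below := p_max _ xA.
apply: (@flip_edge_in [fset p; flip p x]%fset).
  rewrite /flip_edge !inE eqxx /= imfset_fset2 flip_id flipK //.
  by rewrite fsetUC.
apply/boundary_edgeP; exists p, (flip p x); split=> //; first exact: flip_adj.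
by apply/negP => /p_max; exact: flip_above.
Qed.

Lemma min_boundary_attained (n : nat) : boundary_value n (min_boundary n).
Proof. by rewrite /min_boundary; case: ex_minnP => m /asboolP. Qed.

Lemma min_boundary_le (A : {fset nat * nat}) :
  min_boundary #|` A|%fset <= boundary_size A.
Proof.
rewrite /min_boundary; case: ex_minnP => m _; apply.
by apply/asboolP; exists A.
Qed.

Lemma min_boundary_nondecreasing : {homo min_boundary : m n / m <= n}.
Proof.
apply: homo_leq => [n|b a c|n]; [exact: leqnn|exact: leq_trans|].
have [A [An <-]] := min_boundary_attained n.+1.
have [p pA p_max] : exists2 p : nat * nat, p \in A &
    forall z : nat * nat, z \in A -> z.2 < p.2 \/ z.2 = p.2 /\ z.1 <= p.1.
  by apply: topmost_rightmost; rewrite -size_eq0 An.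
have <- : #|` (A `\ p)|%fset = n by have := cardfsD1 p A; rewrite pA An; lia.
exact: leq_trans (min_boundary_le _) (boundary_size_delete_corner pA p_max).
Qed.

(** An edge leaving the square [0, m) x [0, m] is determined by its outer
    endpoint, one of at most [2 (m + 1)] points, and by one of the 9 positions
    of the inner endpoint relative to it.  Only the order of magnitude
    matters. *)
Lemma min_boundary_square (m : nat) : min_boundary (m * m) <= 18 * m.+1.
Proof.
pose square := [fset z | z in [seq (i, j) | i <- iota 0 m, j <- iota 0 m]]%fset.
have squareE z : (z \in square) = (z.1 < m) && (z.2 < m).
  rewrite !inE /=; apply/allpairsP/andP => /= [[[i j] [/= + + ->]]|[z1 z2]].
    by rewrite !mem_iota.
  by exists z; rewrite !mem_iota /= !add0n; case: z z1 z2.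
have <- : #|` square|%fset = m * m.
  rewrite card_imfset //= undup_id ?size_allpairs ?size_iota //.
  by apply: allpairs_uniq; rewrite ?iota_uniq // => -[? ?] [? ?].
apply: leq_trans (min_boundary_le _) _.
pose outer := [seq (m, j) | j <- iota 0 m.+1] ++ [seq (i, m) | i <- iota 0 m.+1].
(* The offset [(1, 1)] stands for a zero displacement. *)
pose offsets := [seq (i, j) | i <- iota 0 3, j <- iota 0 3].
pose edge y d : {fset nat * nat} :=
  [fset ((y.1 + d.1).-1, (y.2 + d.2).-1); y]%fset.
have -> : 18 * m.+1 = size [seq edge y d | y <- outer, d <- offsets].
  by rewrite !size_allpairs size_cat !size_map !size_iota; lia.
apply: boundary_size_le => e /boundary_edgeP[[a b] [[c d] []]].
move=> xy ab cd ->; rewrite !squareE /adj /dist_infty /= in xy ab cd.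
have outer_cd : (c, d) \in outer.
  rewrite mem_cat; apply/orP; have [cm|cm] := leqP m c; [left|right].
    have -> : c = m by lia.
    by apply: map_f; rewrite mem_iota; lia.
  have -> : d = m by lia.
  by apply: (map_f (fun i => (i, m))); rewrite mem_iota; lia.
have offset_ab : (a.+1 - c, b.+1 - d) \in offsets.
  by apply: allpairs_f; rewrite mem_iota; lia.
have -> : [fset (a, b); (c, d)]%fset = edge (c, d) (a.+1 - c, b.+1 - d).
  by congr [fset (_, _); _]%fset => /=; lia.
exact: allpairs_f.
Qed.

(** If every window of length [L] saw an increase, then [g (1 + j * L)] would be
    at least [j]; taking [j] linear in [m] but above the bound on [g (m * m)],
    with [1 + j * L <= m * m], is contradictory. *)
Lemma long_constant_run (g : nat -> nat) (c : nat) :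
  {homo g : m n / m <= n} -> (forall m, g (m * m) <= c * m.+1) ->
  forall L, exists n, 1 <= n /\ forall k, k <= L -> g (n + k) = g n.
Proof.
move=> g_mono g_le L; apply: contrapT => no_run.
have step n : 1 <= n -> g n < g (n + L).
  move=> n_gt0; rewrite ltnNge; apply/negP => gL; apply: no_run; exists n.
  split=> // k kL; apply/eqP; rewrite eqn_leq [X in _ && X]g_mono ?leq_addr //.
  by rewrite andbT (leq_trans _ gL) // g_mono // leq_add2l.
have grow j : j <= g (1 + j * L).
  elim: j => // j IHj; apply: leq_ltn_trans IHj _.
  have -> : 1 + j.+1 * L = (1 + j * L) + L by lia.
  exact: step.
pose m := (c.+1).*2 * L.+1.
have jL : 1 + (c * m.+1).+1 * L <= m * m by rewrite /m -!muln2; nia.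
by have := leq_trans (grow _) (leq_trans (g_mono _ _ jL) (g_le m)); rewrite ltnn.
Qed.

Theorem corollary12 :
  forall L : nat, exists n : nat,
    1 <= n /\ forall k : nat, k <= L -> min_boundary (n + k) = min_boundary n.
Proof.
exact: long_constant_run min_boundary_nondecreasing min_boundary_square.
Qed.
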